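(* For all integers $n\ge 3$ the following hold, where $[e_\mu]X$ denotes the coefficient of $e_\mu$ in the expansion of the symmetric function $X$ in the elementary basis. 1) If $n$ is even, then $[e_{(n+1,\,n-1)}]X_{S(n;1)}=2n(1-n)$. 2) If $n$ is odd, then $[e_{(n,\,n)}]X_{S(n;1)}=n(1-n)$. 3) If $k\ge 2$ is an integer and $n(k+1)$ is even, then $\left[e_{\left(\frac{n(k+1)}{2}+1,\ \frac{n(k+1)}{2}-1\right)}\right]X_{S(n;k)}=n(k+1)(1-n)$. 4) If $k\ge 2$ is an integer and $n(k+1)$ is odd, then $\left[e_{\left(\frac{n(k+1)+1}{2},\ \frac{n(k+1)-1}{2}\right)}\right]X_{S(n;k)}=n(k+1)(1-n)$.
   Context: All graphs are finite and simple. $P_k$ denotes the path with $k$ vertices; for $k=1$ the single vertex counts as its leaf. For $n\ge 3$ and $k\ge 1$, the sun graph $S(n;k)$ is obtained from the cycle $C_n$ with consecutive vertices $v_1,\ldots,v_n$ and $n$ disjoint copies of the path $P_k$ (disjoint from the cycle) by connecting, for every $i$, the vertex $v_i$ by an edge to a leaf of the $i$-th copy. It has $n(k+1)$ vertices. The chromatic symmetric function of a graph $G$ with vertices $v_1,\ldots,v_d$ is $X_G=\sum_{\kappa} x_{\kappa(v_1)}\cdots x_{\kappa(v_d)}$, the sum over all proper colourings $\kappa:V(G)\to\mathbb{N}$, with $x_1,x_2,\ldots$ commuting variables. The elementary basis of the algebra of symmetric functions (over $\mathbb{Q}$) consists of $e_\lambda=e_{\lambda_1}e_{\lambda_2}\cdots$,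 $\lambda$ an integer partition, where $e_i=\sum_{j_1<\cdots<j_i}x_{j_1}\cdots x_{j_i}$. *)

(* Defs.v *)
From mathcomp Require Import all_boot all_order all_algebra.
From mathcomp Require Import finmap multiset.
From mathcomp Require Import boolp classical_sets fsbigop.

Set Implicit Arguments.
Unset Strict Implicit.
Unset Printing Implicit Defensive.

Import GRing.Theory.

Record sgraph := SGraph {
  vertex :> finType;
  adj : rel vertex;
  adj_sym : symmetric adj;
  adj_irr : irreflexive adj }.

(* [inl i] is the cycle vertex v_i and [inr (i, j)] is the j-th vertex of the
   i-th copy of the path, numbered from the leaf that is joined to v_i.
   The disequality only matters for n <= 1. *)
Definition sun_rel (n k : nat) : rel ('I_n + 'I_n * 'I_k) := fun x y =>
  match x, y with
  | inl i, inl j =>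
      (i != j) && ((j == i.+1 %% n :> nat) || (i == j.+1 %% n :> nat))
  | inr (i, a), inr (j, b) =>
      (i == j) && ((b == a.+1 :> nat) || (a == b.+1 :> nat))
  | inl i, inr (j, a) | inr (j, a), inl i => (i == j) && (a == 0 :> nat)
  end.
Arguments sun_rel : clear implicits.

Lemma sun_sym n k : symmetric (sun_rel n k).
Proof.
by move=> [i|[i a]] [j|[j b]] //=; rewrite eq_sym orbC.
Qed.

Lemma sun_irr n k : irreflexive (sun_rel n k).
Proof.
by move=> [i|[i a]] /=; rewrite eqxx //= orbb ltn_eqF.
Qed.

Definition sun (n k : nat) : sgraph := SGraph (@sun_sym n k) (@sun_irr n k).

Local Open Scope ring_scope.
Local Open Scope mset_scope.

(* Formal power series over rat in the variables x_0, x_1, ..., given by their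
   coefficients; a monomial is the finite multiset of its variable indices, so
   that [A `+` B] is the product of the monomials A and B. *)
Definition series := {mset nat} -> rat.

Definition series1 : series := fun m => (m == mset0)%:R.

(* The index set below is finite, so the finitely supported sum is the
   Cauchy product. *)
Definition series_mul (f g : series) : series := fun m =>
  \sum_(p \in [set p : {mset nat} * {mset nat} | (p.1 `+` p.2)%mset = m]%classic)
     f p.1 * g p.2.

Definition proper_colouring (G : sgraph) (kappa : {ffun G -> nat}) : Prop :=
  forall x y : G, adj x y -> kappa x <> kappa y.

Definition colouring_monomial (G : sgraph) (kappa : {ffun G -> nat}) :
  {mset nat} := seq_mset [seq kappa v | v <- enum G].

(* The coefficient of a monomial counts the proper colourings giving that
   monomial; they are finite in number. *)
Definition chromatic_sym (G : sgraph) : series := fun m =>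
  \sum_(kappa \in [set kappa : {ffun G -> nat} |
          proper_colouring kappa /\ colouring_monomial kappa = m]%classic) (1 : rat).

Definition elem (i : nat) : series := fun m => ((size m == i) && uniq m)%:R.

Definition elem_prod (la : seq nat) : series :=
  \big[series_mul/series1]_(i <- la) elem i.

Definition is_partition (la : seq nat) : bool :=
  sorted geq la && (0%N \notin la).

Definition e_expansion (X : series) (c : {fsfun seq nat -> rat with 0}) : Prop :=
  (forall la, la \in finsupp c -> is_partition la) /\
  (forall m, X m = \sum_(la <- finsupp c) c la * elem_prod la m).

(* [e_mu] X = a, for a partition mu.  Asking for the value in every expansion
   besides the existence of one makes this independent of the linear
   independence of the e_la. *)
Definition e_coef (X : series) (mu : seq nat) (a : rat) : Prop :=
  (exists c, e_expansion X c) /\ (forall c, e_expansion X c -> c mu = a).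

(* Main.v *)
Require Import Defs.
From mathcomp Require Import finmap multiset.
From mathcomp Require Import boolp classical_sets functions fsbigop.
From mathcomp Require Import mpoly.
From mathcomp Require Import all_boot all_order all_algebra.
From mathcomp Require Import algC zify ring.

(** The argument starts from the observation that a sun graph is a functional
    graph: give each cycle vertex its successor on the cycle and each pendant
    vertex its neighbour towards the cycle; then the edges are exactly the
    pairs [v], [f v] ([sun_relE]), and the cycle is the set of vertices that
    every vertex reaches ([core]).

    For a functional graph whose core is not empty, inclusion-exclusion over
    the vertices [v] with [kappa v = kappa (f v)] writes the chromatic function
    as a signed sum over sets [S] of vertices (that is, of edges).  If [S]
    misses a core vertex, following [f] inside [S] leads each vertex to a
    unique [sink] outside [S], a colouring constant along [S] is determined by
    the colours of the sinks, and the inner sum is the product of the power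
    sums p_s over the sizes s of the basins of the sinks.  If [S] contains the
    core, one edge of the cycle is redundant and may be dropped ([trim]).
    This is the power-sum expansion [chromatic_sum_psum].

    Let a + b = n(k+1) with b <= a < 2 b.  The coefficient of e_(a,b) is read
    off by evaluating at a point [y] whose elementary symmetric functions of
    positive index vanish except e_a = 'X^a and e_b = 'X^b: there every e_lambda
    but e_(a,b) becomes 0 or a power of 'X other than 'X^(a+b)
    ([e_coef_two_parts]).  Such points exist over an algebraically closed field
    ([two_part_point]).  By Newton's identities, the power sums at [y] of
    positive index below a vanish except p_b, and p_(a+b) is, up to sign and
    power of 'X, equal to a + b, or to a when a = b.  A summand of the power-sum expansion with two or more basins
    therefore vanishes unless there are exactly two, of sizes a and b
    ([prod_psum_basin_eq0]).  In a sun graph this never happens: a basin of a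
    pendant vertex has at most k < b elements, and when all sinks lie on the
    cycle the basins are unions of whole rays, so that their sizes are
    multiples of k + 1, which does not divide b.  What is left are the spanning
    connected edge sets: all the edges, and all but one of the n cycle edges.
    They contribute p_(a+b) times 1 - n, up to a sign that cancels the one of
    p_(a+b), which gives the stated values ([chromatic_sum_sun]).

    Series are handled through their truncations to polynomials in [M]
    variables, for all [M] at once ([truncates]).  An elementary expansion
    exists because the power sums are, by Newton's identities, combinations of
    products of elementary polynomials whose coefficients do not depend on the
    number of variables ([e_span]). *)

Set Implicit Arguments.
Unset Strict Implicit.
Unset Printing Implicit Defensive.

Import GRing.Theory.

Local Open Scope mset_scope.
Local Open Scope ring_scope.

(** * Power sums and elementary sums *)

Lemma deriv_prod (R : comNzRingType) (I : finType) (F : I -> {poly R}) :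
  (\prod_i F i)^`() = \sum_i (F i)^`() * \prod_(j | j != i) F j.
Proof.
suff main (r : seq I) : uniq r -> (\prod_(i <- r) F i)^`() =
    \sum_(i <- r) (F i)^`() * \prod_(j <- r | j != i) F j.
  exact: main (index_enum_uniq I).
elim: r => [_|i r IHr /= /andP[ir ur]]; first by rewrite !big_nil derivC.
rewrite !big_cons derivM IHr // eqxx /=; congr (_ * _ + _).
  rewrite [RHS]big_seq_cond [LHS]big_seq; apply: eq_bigl => j.
  by case: eqP => [->|]; rewrite ?(negPf ir) ?andbT.
rewrite big_distrr /= !big_seq; apply: eq_bigr => j jr.
by rewrite big_cons (_ : i != j) 1?mulrCA //; apply: contraNneq ir => ->.
Qed.

Section Sums.
Variables (R : comNzRingType) (M : nat) (x : 'I_M -> R).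

Definition psum (j : nat) : R := \sum_i x i ^+ j.

Definition esum (j : nat) : R := \sum_(A : {set 'I_M} | #|A| == j) \prod_(i in A) x i.

(** The generating polynomial of the elementary sums, with the signs that make
    Newton's identities free of alternating signs. *)
Definition epoly : {poly R} := \prod_i (1 - x i *: 'X).

Lemma coef_epoly j : epoly`_j = (-1) ^+ j * esum j.
Proof.
rewrite /epoly (eq_bigr (fun i => - x i *: 'X + 1)); last first.
  by move=> i _; rewrite addrC scaleNr.
rewrite bigA_distr /= coef_sum /esum big_distrr /= [RHS]big_mkcond /=.
apply: eq_bigr => A _.
rewrite -big_mkcond /= scaler_prod prodrN prodr_const coefZ coefXn eq_sym.
by case: eqP => [->|_]; rewrite ?mulr1 ?mulr0.
Qed.

Lemma coef0_epoly : epoly`_0 = 1.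
Proof.
rewrite coef_epoly mul1r /esum (big_pred1 set0) ?big_set0 // => A.
exact: cards_eq0.
Qed.

(** Newton's identities, from the logarithmic derivative of [epoly]: removing
    the factor [1 - x i *: 'X] from [epoly] leaves the polynomial [F i], whose
    coefficients are partial convolutions of those of [epoly] with the powers
    of [x i]. *)
Lemma newton j : j.+1%:R * epoly`_j.+1 = - \sum_(l < j.+1) epoly`_l * psum (j.+1 - l).
Proof.
pose F i := \prod_(k | k != i) (1 - x k *: 'X).
have epolyF i : epoly = (1 - x i *: 'X) * F i by rewrite /epoly (bigD1 i).
have coefF i m : (F i)`_m = \sum_(l < m.+1) epoly`_l * x i ^+ (m - l).
  elim: m => [|m IHm].
    rewrite big_ord1 (epolyF i) mulrBl mul1r -scalerAl coefB coefZ coefXM.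
    by rewrite mulr0 subr0 mulr1.
  rewrite big_ord_recr subnn mulr1 /=.
  rewrite (eq_bigr (fun l : 'I_m.+1 => x i * (epoly`_l * x i ^+ (m - l)))).
    rewrite -big_distrr -IHm /= (epolyF i) mulrBl mul1r -scalerAl coefB coefZ coefXM /=.
    by rewrite addrC subrK.
  by move=> l _; rewrite subSn -1?ltnS // exprS mulrCA.
have deriv_epoly : epoly^`() = - \sum_i x i *: F i.
  rewrite /epoly deriv_prod -sumrN; apply: eq_bigr => i _.
  by rewrite -/(F i) derivB derivC derivZ derivX sub0r alg_polyC mulNr mul_polyC.
rewrite mulr_natl -coef_deriv deriv_epoly coefN coef_sum; congr (- _).
rewrite (eq_bigr (fun i => \sum_(l < j.+1) epoly`_l * x i ^+ (j.+1 - l))).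
  by rewrite exchange_big /=; apply: eq_bigr => l _; rewrite /psum big_distrr.
move=> i _; rewrite coefZ coefF big_distrr; apply: eq_bigr => l _.
by rewrite subSn -1?ltnS // exprS mulrCA.
Qed.
End Sums.

(** * Colourings of a functional graph *)

Section FunctionalGraph.
Variables (V : finType) (f : V -> V).

Definition proper_map (M : nat) (kappa : {ffun V -> 'I_M}) : bool :=
  [forall v, kappa v != kappa (f v)].

Definition constant_along (S : {set V}) (M : nat) (kappa : {ffun V -> 'I_M}) : bool :=
  [forall (v | v \in S), kappa v == kappa (f v)].

(** When it is not empty, this is the vertex set of the unique cycle of a
    connected functional graph. *)
Definition core : {set V} := [set c | [forall v, fconnect f v c]].

(** For [c] in [core], a set of edges with the same connected components as
    [S] that does not contain the whole cycle. *)
Definition trim (c : V) (S : {set V}) : {set V} :=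
  if core \subset S then S :\ c else S.

(** The edges of [S] are the pairs [v], [f v] with [v] in [S].  If [S] misses a
    vertex of [core], they form a forest whose roots are the vertices outside
    [S], and [sink] finds the root of the tree of [v]; the number of iterations
    only has to be large enough. *)
Definition step (S : {set V}) (v : V) : V := if v \in S then f v else v.

Definition sink (S : {set V}) (v : V) : V := iter #|V| (step S) v.

Definition basin (S : {set V}) (w : V) : {set V} := [set v | sink S v == w].

Lemma f_core c : c \in core -> f c \in core.
Proof.
rewrite !inE => /forallP cc; apply/forallP => v.
exact: connect_trans (cc v) (fconnect1 _ _).
Qed.

Lemma step_out (S : {set V}) v n : v \notin S -> iter n (step S) v = v.
Proof. by move=> vS; elim: n => //= n ->; rewrite /step (negPf vS). Qed.

(** The [f]-orbit of [v] passes through [c], hence leaves [S]; the walk under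
    [step] agrees with it up to that moment and is stationary afterwards. *)
Lemma sink_out (S : {set V}) v c : c \in core -> c \notin S -> sink S v \notin S.
Proof.
rewrite inE => /forallP /(_ v) vc cS.
have le : (findex f v c <= #|V|)%N.
  by rewrite (leq_trans (ltnW (findex_max vc))) // max_card.
suff H n u : iter n f u \notin S -> iter n (step S) u \notin S.
  by rewrite /sink -(subnK le) iterD step_out; apply: H; rewrite iter_findex.
elim: n u => // n IHn u; rewrite !iterSr => nS.
have [uS|uS] := boolP (u \in S); first by rewrite /step uS IHn.
by rewrite {2}/step (negPf uS) step_out.
Qed.

Lemma sink_id (S : {set V}) w : w \notin S -> sink S w = w.
Proof. exact: step_out. Qed.

Lemma sink_step (S : {set V}) v c : c \in core -> c \notin S ->
  sink S (step S v) = sink S v.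
Proof.
move=> cc cS; rewrite /sink -iterSr /= -/(sink S v) /step.
by rewrite (negPf (sink_out v cc cS)).
Qed.

Lemma constant_along_sink (S : {set V}) c M (kappa : {ffun V -> 'I_M}) :
  c \in core -> c \notin S ->
  constant_along S kappa = (kappa == [ffun v => kappa (sink S v)]).
Proof.
move=> cc cS; apply/forall_inP/eqP => [ks|-> v vS]; last first.
  by rewrite !ffunE -(sink_step v cc cS) /step vS.
apply/ffunP => v; rewrite ffunE /sink; elim: #|V| v => // n IHn v.
rewrite iterSr -IHn /step; case: ifP => // vS.
exact/eqP/ks.
Qed.

(** Walking around the cycle from [f c] back to [c] uses no edge but those of
    [S :\ c], so that the constraint at [c] follows from the other ones. *)
Lemma constant_along_core (S : {set V}) c M (kappa : {ffun V -> 'I_M}) :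
  c \in core -> core \subset S ->
  constant_along (S :\ c) kappa = constant_along S kappa.
Proof.
move=> cc coreS; apply/forall_inP/forall_inP => ks v; last first.
  by move=> /setD1P[_]; apply: ks.
move=> vS; have [->|vc] := eqVneq v c; last by apply: ks; rewrite !inE vc.
have fcc : fconnect f (f c) c by move: cc; rewrite inE => /forallP.
have H n : (n <= findex f (f c) c)%N -> kappa (iter n f (f c)) = kappa (f c).
  elim: n => // n IHn lt; rewrite -IHn ?(ltnW lt) //=.
  symmetry; apply/eqP/ks; rewrite !inE; apply/andP; split.
    apply/eqP => E; move: (lt).
    rewrite -{1}(findex_iter (ltn_trans lt (findex_max fcc))).
    by rewrite E ltnn.
  apply: (subsetP coreS); elim: (n) => [|m]; exact: f_core.
by rewrite -(H _ (leqnn _)) iter_findex.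
Qed.

Section Evaluation.
Variables (R : comNzRingType) (M : nat) (x : 'I_M -> R).

Definition chromatic_sum : R :=
  \sum_(kappa : {ffun V -> 'I_M} | proper_map kappa) \prod_v x (kappa v).

(** Expansion of the product over [v] of [1 - [kappa v = kappa (f v)]], which
    is the indicator of properness. *)
Lemma chromatic_sum_incl_excl : chromatic_sum =
  \sum_(S : {set V}) (-1) ^+ #|S| *
    \sum_(kappa : {ffun V -> 'I_M} | constant_along S kappa) \prod_v x (kappa v).
Proof.
under eq_bigr do rewrite big_distrr /= big_mkcond /=.
rewrite exchange_big /chromatic_sum big_mkcond /=; apply: eq_bigr => kappa _.
pose b v := kappa v == kappa (f v).
have -> : (if proper_map kappa then \prod_v x (kappa v) else 0) =
    (\prod_v (- (b v)%:R + 1)) * \prod_v x (kappa v).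
  case: ifP => [/forallP p|/forallPn[v /negPn pv]].
    by rewrite [X in X * _]big1 ?mul1r // => v _; rewrite /b (negPf (p v)) oppr0 add0r.
  by rewrite (bigD1 v) //= /b pv addNr !mul0r.
rewrite bigA_distr /= big_distrl /=; apply: eq_bigr => S _.
rewrite -big_mkcond /= prodrN.
have -> : \prod_(v in S) (b v)%:R = (constant_along S kappa)%:R :> R.
  rewrite /constant_along; case: forall_inP => [p|/forall_inP].
    by rewrite big1 // => v /p; rewrite /b => ->.
  rewrite negb_forall_in => /exists_inP[v vS nv].
  by rewrite (bigD1 v) //= /b (negPf nv) mul0r.
by case: constant_along; rewrite ?mulr1 ?mulr0 ?mul0r.
Qed.

(** Such a colouring amounts to a free choice of the colours of the sinks, and
    the colour of a sink counts once for each vertex of its basin. *)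
Lemma sum_constant_along (S : {set V}) c : c \in core -> c \notin S ->
  \sum_(kappa : {ffun V -> 'I_M} | constant_along S kappa) \prod_v x (kappa v) =
  \prod_(w in ~: S) psum x #|basin S w|.
Proof.
move=> cc cS; have outP v : sink S v \in ~: S by rewrite inE (sink_out v cc cS).
rewrite (eq_bigl _ _ (fun kappa => constant_along_sink kappa cc cS)).
pose T := {w | w \in ~: S}.
pose ext (g : {ffun T -> 'I_M}) : {ffun V -> 'I_M} :=
  [ffun v => g (Sub (sink S v) (outP v))].
pose res (kappa : {ffun V -> 'I_M}) : {ffun T -> 'I_M} := [ffun w => kappa (val w)].
rewrite (reindex_onto ext res) /=; last first.
  by move=> kappa /eqP kE; apply/ffunP => v; rewrite [in RHS]kE !ffunE.
rewrite (eq_bigl xpredT); last first.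
  move=> g /=; apply/andP; split; apply/eqP/ffunP => v; rewrite !ffunE.
    by congr (g _); apply: val_inj; rewrite /= [RHS]sink_id // (sink_out v cc cS).
  congr (g _); apply: val_inj; rewrite /= sink_id //.
  by have := valP v; rewrite inE.
under eq_bigr do under eq_bigr do rewrite ffunE.
have fiber (g : {ffun T -> 'I_M}) : \prod_v x (g (Sub (sink S v) (outP v))) =
    \prod_w x (g w) ^+ #|basin S (val w)|.
  rewrite (partition_big (fun v => Sub (sink S v) (outP v) : T) xpredT) //=.
  apply: eq_bigr => w _; rewrite -prodr_const; apply: eq_big => [v|v /eqP -> //].
  by rewrite inE -val_eqE.
under eq_bigr do rewrite fiber.
rewrite -(bigA_distr_bigA (fun w i => x i ^+ #|basin S (val w)|)) /=.
by rewrite -(big_sub _ (fun w => psum x #|basin S w|)).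
Qed.

(** A set containing the cycle is replaced by its [trim], which imposes the same
    constraint on colourings and leaves every vertex with a sink. *)
Theorem chromatic_sum_psum c : c \in core -> chromatic_sum =
  \sum_(S : {set V}) (-1) ^+ #|S| *
    \prod_(w in ~: trim c S) psum x #|basin (trim c S) w|.
Proof.
move=> cc; rewrite chromatic_sum_incl_excl; apply: eq_bigr => S _; congr (_ * _).
rewrite /trim; case: ifPn => [sub|/subsetPn[d dc dS]]; last exact: sum_constant_along dS.
rewrite -(eq_bigl _ _ (fun kappa => constant_along_core kappa cc sub)).
by apply: (sum_constant_along cc); rewrite !inE eqxx.
Qed.

(** A single sink is left by the whole vertex set, after trimming, and by the
    complements of single core vertices; these are the connected spanning
    subgraphs, and their basin is the whole vertex set. *)
Lemma chromatic_sum_connected c : c \in core ->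
  (forall (S : {set V}) d, d \in core -> d \notin S -> (1 < #|~: S|)%N ->
     \prod_(w in ~: S) psum x #|basin S w| = 0) ->
  chromatic_sum = (-1) ^+ #|V| * psum x #|V| * (1 - #|core|%:R).
Proof.
move=> cc vanish; rewrite (chromatic_sum_psum cc).
have one d : d \in core ->
    \prod_(w in ~: (~: [set d])) psum x #|basin (~: [set d]) w| = psum x #|V|.
  move=> dc; rewrite setCK big_set1 -cardsT; congr (psum x #|pred_of_set _|).
  apply/setP => v; rewrite !inE; have := @sink_out (~: [set d]) v d dc.
  by rewrite !inE eqxx !negbK => ->.
(* The sets are split into [setT], the complements of core vertices and the
   others, which leave at least two sinks. *)
rewrite (bigD1 [set: V]) //= (bigID (fun S => [exists w in core, S == ~: [set w]])) /=.
rewrite [X in _ + (_ + X)]big1 ?addr0; last first.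
  move=> S /andP[ST /exists_inPn Sw]; rewrite /trim.
  case: ifPn => [sub|/subsetPn[d dc dS]].
    rewrite (vanish _ c) ?mulr0 // ?inE ?eqxx // setCD.
    have /subsetPn[v _ vS] : ~~ ([set: V] \subset S) by rewrite subTset.
    have vc : v != c by apply: contraNneq vS => ->; apply: (subsetP sub).
    rewrite (cardsD1 v) !inE vS (cardsD1 c) !inE eqxx [c == v]eq_sym vc orbT.
    by rewrite addnA.
  rewrite (vanish _ d) ?mulr0 // (cardsD1 d) !inE dS ltnS lt0n cards_eq0.
  apply: contra (Sw _ dc) => /eqP dE; apply/eqP/setP => v; rewrite !inE.
  have := in_set0 v; rewrite -dE !inE; case: eqP => [->|_ /negbFE -> //].
  by rewrite (negPf dS).
rewrite (_ : trim c setT = ~: [set c]); last by rewrite /trim subsetT setTD.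
rewrite one // cardsT (eq_bigr (fun=> - ((-1) ^+ #|V| * psum x #|V|))); last first.
  move=> S /andP[_ /exists_inP[w wc /eqP ->]].
  rewrite /trim (_ : core \subset _ = false) ?one //; last first.
    by apply/negbTE/subsetPn; exists w; rewrite // !inE eqxx.
  have -> : #|V| = #|~: [set w]|.+1.
    by rewrite cardsC1 prednK //; apply/card_gt0P; exists w.
  by rewrite exprS mulN1r mulNr opprK.
rewrite sumr_const mulrBr mulr1 mulr_natr -mulNrn; congr (_ + _ *+ _).
rewrite -(card_imset _ (f := fun w => ~: [set w] : {set V})); last first.
  by move=> w w' /setC_inj /set1_inj.
apply: eq_card => S; rewrite unfold_in /=; apply/andP/imsetP => [[_]|[w wc ->]].
  by move/exists_inP => [w wc /eqP ->]; exists w.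
split; last by apply/exists_inP; exists w.
by apply/eqP => /setP/(_ w); rewrite !inE eqxx.
Qed.
End Evaluation.
End FunctionalGraph.

(** * Points where only two elementary sums survive *)

Section TwoParts.
Variables (R : comNzRingType) (M : nat) (x : 'I_M -> R) (u : R) (a b : nat).
Hypotheses (b_gt0 : (0 < b)%N) (le_ba : (b <= a)%N) (lt_a2b : (a < 2 * b)%N).
Hypothesis esum_x : forall l, (0 < l)%N -> esum x l = u ^+ l *+ ((l == a) || (l == b)).

Let E_ l : R := (epoly x)`_l.

Let E0 : E_ 0 = 1.
Proof. exact: coef0_epoly. Qed.

Let E_part l : (l == a) || (l == b) -> E_ l = (- u) ^+ l.
Proof.
move=> lab; have l_gt0 : (0 < l)%N by lia.
by rewrite /E_ coef_epoly esum_x // lab mulr1n [RHS]exprNn.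
Qed.

Let E_nonpart l : (0 < l)%N -> l != a -> l != b -> E_ l = 0.
Proof.
by move=> l0 /negPf la /negPf lb; rewrite /E_ coef_epoly esum_x // la lb mulr0n mulr0.
Qed.

Let newton_rec s : (0 < s)%N ->
  psum x s = - (s%:R * E_ s) - \sum_(1 <= l < s) E_ l * psum x (s - l).
Proof.
case: s => // s _; have := newton x s; rewrite -/(E_ _) => ->; rewrite opprK.
rewrite -(big_mkord xpredT (fun l => E_ l * psum x (s.+1 - l))) /=.
by rewrite big_ltn // E0 mul1r subn0 addrK.
Qed.

(** In Newton's recursion for p_s only the term e_b p_(s-b) can survive, and
    there s - b < a - b < b. *)
Lemma psum_non_part s : (0 < s < a)%N -> s != b -> psum x s = 0.
Proof.
elim/ltn_ind: s => s IHs /andP[s0 sa] sb.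
rewrite newton_rec // (E_nonpart s0) // 1?ltn_eqF // mulr0 oppr0 sub0r.
rewrite big_nat big1 ?oppr0 // => l /andP[l0 ls].
have [lb|lb] := eqVneq l b; last by rewrite E_nonpart ?mul0r //; lia.
by rewrite lb IHs ?mulr0 //; lia.
Qed.

Let psum_part s : (s == a) || (s == b) -> psum x s = - (s%:R * E_ s).
Proof.
move=> sab; rewrite newton_rec; last lia.
rewrite big_nat big1 ?subr0 // => l /andP[l0 ls].
have [lb|lb] := eqVneq l b; last by rewrite E_nonpart ?mul0r //; lia.
by rewrite lb psum_non_part ?mulr0 //; lia.
Qed.

(** Newton's recursion has the two terms e_a p_b and e_b p_a, which coincide
    when a = b; hence the case distinction. *)
Lemma psum_total :
  psum x (a + b) = (-1) ^+ (a + b) * u ^+ (a + b) *+ (if a == b then a else (a + b)%N).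
Proof.
have -> : (-1) ^+ (a + b) * u ^+ (a + b) = E_ a * E_ b.
  by rewrite !E_part ?eqxx ?orbT // -exprD [RHS]exprNn.
rewrite newton_rec ?(@E_nonpart (a + b)); try lia.
rewrite mulr0 oppr0 sub0r (bigD1_seq a) ?mem_index_iota ?iota_uniq //=; try lia.
have rest (P : pred nat) : (forall l, P l -> l != a /\ l != b) ->
    \sum_(1 <= l < a + b | P l) E_ l * psum x (a + b - l) = 0.
  move=> Pab; rewrite big_nat_cond big1 // => l /andP[/andP[l0 _] /Pab[la lb]].
  by rewrite E_nonpart ?mul0r.
rewrite addKn psum_part ?eqxx ?orbT //; case: eqP => [ab|/eqP ab].
  rewrite rest; last by move=> l; rewrite -ab.
  rewrite -ab -[RHS]mulr_natr; ring.
rewrite big_mkcond (bigD1_seq b) ?mem_index_iota ?iota_uniq //=; try lia.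
rewrite -big_mkcondr eq_sym ab addnK psum_part ?eqxx // rest; last first.
  by move=> l /andP[].
by rewrite -[RHS]mulr_natr natrD; ring.
Qed.

(** If no factor is zero, all basins have at least b elements, hence sizes
    divisible by q; then no size is b, and all of them are at least a.  But two
    disjoint sets of at least a elements among a + b vertices have size b. *)
Lemma prod_psum_basin_eq0 (V : finType) (f : V -> V) (S : {set V}) (q : nat) :
  #|V| = (a + b)%N -> (1 < #|~: S|)%N -> ~~ (q %| b)%N ->
  ((forall w, w \notin S -> (b <= #|basin f S w|)%N) ->
     forall w, w \notin S -> (q %| #|basin f S w|)%N) ->
  \prod_(w in ~: S) psum x #|basin f S w| = 0.
Proof.
move=> cardV /card_gt1P[w1 [w2 [w1S w2S w12]]] qb big_dvd.
have [/exists_inP[w wS /eqP w0]|/exists_inPn nz] :=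
  boolP [exists w in ~: S, psum x #|basin f S w| == 0].
  by rewrite (bigD1 w) //= w0 mul0r.
have large w : w \notin S -> (b <= #|basin f S w|)%N.
  move=> wS; have := nz w; rewrite inE => /(_ wS); apply: contraNleq => lt.
  have basin_gt0 : (0 < #|basin f S w|)%N.
    by apply/card_gt0P; exists w; rewrite inE sink_id.
  by rewrite psum_non_part //; lia.
have larger w : w \notin S -> (a <= #|basin f S w|)%N.
  move=> wS; have := nz w; rewrite inE => /(_ wS); apply: contraNleq => lt.
  rewrite psum_non_part //; first by rewrite lt andbT (leq_trans b_gt0 (large w wS)).
  by apply: contraNneq qb => <-; apply: big_dvd.
move: w1S w2S; rewrite !inE => w1S w2S.
have : (#|basin f S w1| + #|basin f S w2| <= a + b)%N.
  rewrite -cardV -cardsUI (_ : _ :&: _ = set0) ?cards0 ?addn0 ?max_card //.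
  by apply/setP => v; rewrite !inE; apply: contraNF w12 => /andP[/eqP <-].
move=> le; have E2 : #|basin f S w2| = b.
  by have := larger _ w1S; have := larger _ w2S; lia.
by case/negP: qb; rewrite -E2; apply: big_dvd.
Qed.
End TwoParts.

(** * Sun graphs as functional graphs *)

Section Sun.
Variables (n k : nat).

(** Orientation of the sun graph: around the cycle, and towards it along the
    pendant paths. *)
Definition sun_next (v : 'I_n + 'I_n * 'I_k) : 'I_n + 'I_n * 'I_k :=
  match v with
  | inl i => inl (ordS i)
  | inr (i, j) => if j == 0 :> nat then inl i else inr (i, ord_pred j)
  end.

Lemma ord_predE (j : 'I_k) : (0 < j)%N -> ord_pred j = j.-1 :> nat.
Proof.
by case: j => [[|j] lt] //= _; rewrite modnDr modn_small // ltnW.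
Qed.

Lemma sun_relE x y : (1 < n)%N -> sun_rel n k x y = (y == sun_next x) || (x == sun_next y).
Proof.
move=> n1; case: x y => [i|[i a]] [j|[j b]] //=.
- have [->|_] := eqVneq i j; last by [].
  symmetry; apply/negbTE; rewrite orbb; apply/negP => /eqP[/(congr1 val) /= E].
  have lt := ltn_ord j; have [lt'|ge] := ltnP j.+1 n; first by rewrite modn_small // in E; lia.
  have En : n = j.+1 by lia.
  by rewrite -En modnn in E; lia.
- by have [b0|b0] := eqVneq (b : nat) 0%N; rewrite ?andbF ?andbT.
- by have [a0|a0] := eqVneq (a : nat) 0%N; rewrite ?andbF ?andbT ?orbF // eq_sym.
- rewrite -[RHS]orbC.
have H (i' j' : 'I_n) (c d : 'I_k) :
    (i' == j') && (d == c.+1 :> nat) =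
    (inr (i', c) == if d == 0 :> nat then inl j'
                    else inr (j', ord_pred d) :> 'I_n + 'I_n * 'I_k).
  have [d0|d0] := eqVneq (d : nat) 0%N; first by rewrite d0 andbF.
  rewrite (inj_eq inr_inj) xpair_eqE; congr (_ && _).
  rewrite -val_eqE [val (ord_pred d)]ord_predE ?lt0n //=; lia.
by rewrite -!H [j == i]eq_sym andb_orr.
Qed.

Lemma card_sun : #|{: 'I_n + 'I_n * 'I_k}| = (n * k.+1)%N.
Proof. by rewrite card_sum card_prod !card_ord mulnS. Qed.

Lemma iter_sun_next_inl m i : iter m sun_next (inl i) = inl (iter m (@ordS n) i).
Proof. by elim: m => //= m ->. Qed.

Lemma iter_ordS m (i : 'I_n) : iter m (@ordS n) i = ((i + m) %% n)%N :> nat.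
Proof.
elim: m => [|m IHm]; first by rewrite addn0 modn_small.
by rewrite /= IHm -addn1 modnDml addn1 addnS.
Qed.

Lemma fconnect_sun_core v c : fconnect sun_next v (inl c).
Proof.
have cyc i : fconnect sun_next (inl i) (inl c).
  have -> : inl c = iter (c + (n - i))%N sun_next (inl i).
    rewrite iter_sun_next_inl; congr inl; apply: val_inj; rewrite /= iter_ordS.
    by rewrite addnCA subnKC ?modnDr ?modn_small // ltnW.
  exact: fconnect_iter.
case: v => [i|[i [j lt]]]; first exact: cyc.
elim: j lt => [|j IHj] lt.
  exact: connect_trans (fconnect1 sun_next (inr (i, Ordinal lt))) (cyc i).
apply: connect_trans (fconnect1 sun_next (inr (i, Ordinal lt))) _ => /=.
rewrite (_ : ord_pred _ = Ordinal (ltnW lt)); first exact: IHj.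
by apply: val_inj; exact: ord_predE.
Qed.

Lemma core_sun : core sun_next = [set inl i | i in 'I_n].
Proof.
apply/setP => v; rewrite inE; apply/forallP/imsetP => [cv|[i _ ->] w]; last first.
  exact: fconnect_sun_core.
case: v cv => [i|[i j]] cv; first by exists i.
by have := cv (inl i) => /iter_findex; rewrite iter_sun_next_inl.
Qed.

Lemma card_core_sun : #|core sun_next| = n.
Proof. by rewrite core_sun card_imset ?card_ord //; apply: inl_inj. Qed.

Definition sun_ray (v : 'I_n + 'I_n * 'I_k) : 'I_n :=
  match v with inl i => i | inr (i, _) => i end.

(** No edge enters a pendant path from outside, so a basin of one of its
    vertices stays in that path. *)
Lemma basin_sun_pendant S i j : (#|basin sun_next S (inr (i, j))| <= k)%N.
Proof.
pose path_i : {set 'I_n + 'I_n * 'I_k} := [set inr (i, j') | j' in 'I_k].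
have step_path v : step sun_next S v \in path_i -> v \in path_i.
  rewrite /step; case: ifP => // _ /imsetP[j' _].
  by case: v => [//|[i' j'']] /=; case: ifP => // _ [-> _]; apply: imset_f.
have card_path : #|path_i| = k.
  by rewrite card_imset ?card_ord // => j1 j2 [].
rewrite -[X in (_ <= X)%N]card_path; apply/subset_leq_card/subsetP => v; rewrite inE.
rewrite /sink => /eqP sv; have : iter #|{: 'I_n + 'I_n * 'I_k}| (step sun_next S) v \in path_i.
  by rewrite sv; apply: imset_f.
by elim: #|_| (v) => // m IHm u; rewrite iterSr => /IHm; apply: step_path.
Qed.

(** All vertices of a ray flow to the cycle vertex of that ray, because no
    pendant vertex is a sink. *)
Lemma basin_sun_core S w : ~: S \subset core sun_next -> w \notin S ->
  (k.+1 %| #|basin sun_next S w|)%N.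
Proof.
move=> sub wS; have wc : w \in core sun_next by rewrite (subsetP sub) // inE.
have inS i j : inr (i, j) \in S.
  have [//|nS] := boolP (inr (i, j) \in S).
  have : inr (i, j) \in core sun_next by rewrite (subsetP sub) // inE.
  by rewrite core_sun => /imsetP[].
have ray i j : sink sun_next S (inr (i, j)) = sink sun_next S (inl i).
  case: j => j; elim: j => [|j IHj] lt; rewrite -(sink_step _ wc wS) /step inS //=.
  rewrite (_ : ord_pred _ = Ordinal (ltnW lt)); first exact: IHj.
  by apply: val_inj; exact: ord_predE.
rewrite -sum1_card (eq_bigl (fun v => sink sun_next S (inl (sun_ray v)) == w)); last first.
  by case=> [i|[i j]]; rewrite inE //= ray.
rewrite big_mkcond big_sumType /=.
rewrite -(pair_big xpredT xpredT
  (fun i j => if sink sun_next S (inl i) == w then 1 else 0)%N) /=.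
rewrite -big_split /=; apply: dvdn_sum => i _.
by rewrite sum_nat_const card_ord; case: ifP; rewrite ?muln1 ?muln0 ?add1n.
Qed.
End Sun.

(** The connected spanning edge sets are the full one and those missing one
    cycle edge; the sign of p_(a+b) cancels that of the full set. *)
Theorem chromatic_sum_sun (R : comNzRingType) (M : nat) (x : 'I_M -> R) (u : R)
    (n k a b : nat) :
  (b <= a)%N -> (a < 2 * b)%N -> (n * k.+1 = a + b)%N -> (k < b)%N -> ~~ (k.+1 %| b)%N ->
  (forall l, (0 < l)%N -> esum x l = u ^+ l *+ ((l == a) || (l == b))) ->
  chromatic_sum (@sun_next n k) x =
  (if a == b then a else (a + b)%N)%:R * (1 - n%:R) * u ^+ (a + b).
Proof.
move=> le_ba lt_a2b nk kb kNb esumx; have b0 : (0 < b)%N by lia.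
have n0 : (0 < n)%N by lia.
rewrite (@chromatic_sum_connected _ _ _ _ _ (inl (Ordinal n0))).
- rewrite card_core_sun card_sun nk (psum_total b0 le_ba lt_a2b esumx).
  rewrite -[X in _ * X * _]mulr_natr.
  have sgn : (-1) ^+ (a + b) * (-1) ^+ (a + b) = 1 :> R by rewrite -expr2 sqrr_sign.
  by rewrite !mulrA sgn mul1r; ring.
- by rewrite core_sun imset_f.
- move=> S d dc dS S1; apply: (prod_psum_basin_eq0 b0 le_ba lt_a2b esumx _ S1 kNb).
    by rewrite card_sun.
  move=> large w wS; apply: basin_sun_core => //; apply/subsetP => v; rewrite inE => vS.
  case: v vS => [i|[i j]] vS; first by rewrite core_sun imset_f.
  by have := leq_trans (large _ vS) (basin_sun_pendant S i j); rewrite leqNgt kb.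
Qed.

(** * Truncation of a series to finitely many variables *)

Section Truncation.
Variable M : nat.

Definition mset_of (m : 'X_{1..M}) : {mset nat} :=
  seq_mset (flatten [seq nseq (m i) (i : nat) | i <- enum 'I_M]).

Lemma mset_ofE m j : mset_of m j = \sum_(i < M | i == j :> nat) m i.
Proof.
rewrite mset_seqE count_flatten sumn_map big_map enumT [RHS]big_mkcond.
by apply: eq_bigr => i _; rewrite count_nseq /=; case: eqP; rewrite ?mul1n ?mul0n.
Qed.

Lemma mset_of_ord m (i : 'I_M) : mset_of m i = m i.
Proof. by rewrite mset_ofE (big_pred1 i). Qed.

Lemma mset_of_out m j : (M <= j)%N -> mset_of m j = 0%N.
Proof.
by move=> Mj; rewrite mset_ofE big_pred0 // => i; rewrite ltn_eqF // (leq_trans (ltn_ord i)).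
Qed.

Lemma mset_of_inj : injective mset_of.
Proof. by move=> m m' E; apply/mnmP => i; rewrite -!mset_of_ord E. Qed.

Lemma mset_of_surj (A : {mset nat}) :
  (forall j, (M <= j)%N -> A j = 0%N) -> {m | mset_of m = A}.
Proof.
move=> Aout; exists [multinom A i | i < M]; apply/msetP => j.
have [lt|/[dup] ge /Aout ->] := ltnP j M; last by rewrite mset_of_out.
by rewrite -[j]/(val (Ordinal lt)) mset_of_ord mnmE.
Qed.

Lemma mset_ofD m m' : mset_of (m + m')%MM = (mset_of m `+` mset_of m')%mset.
Proof.
apply/msetP => j; rewrite msetE2 !mset_ofE -big_split /=.
by apply: eq_bigr => i _; rewrite mnmE.
Qed.

Lemma mset_of0 : mset_of 0%MM = mset0.
Proof. by apply/msetP => j; rewrite mset0E mset_ofE big1 // => i _; rewrite mnmE. Qed.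

Lemma size_mset_of m : size (mset_of m) = mdeg m.
Proof.
rewrite (perm_size (perm_eq_seq_mset _)) size_flatten /shape -map_comp sumn_map big_enum mdegE.
by apply: eq_bigr => i _; rewrite /= size_nseq.
Qed.

(** [p] is obtained from [f] by setting the variables of index at least [M] to
    zero.  Every monomial involves finitely many variables, so a series is
    known once its truncations are known for all [M]. *)
Definition truncates (f : series) (p : {mpoly rat[M]}) : Prop :=
  forall m, p@_m = f (mset_of m).

Lemma truncates_series1 : truncates series1 1.
Proof. by move=> m; rewrite mcoeff1 /series1 -mset_of0 (inj_eq mset_of_inj). Qed.

Lemma truncates_elem i : truncates (elem i) (mesym M rat i).
Proof.
move=> m; rewrite mcoeff_mesym /mechar /elem size_mset_of; congr ((_ && _)%:R).
apply/forallP/idP => [m1|mu i']; last first.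
  by rewrite -mset_of_ord -count_mem_mset count_uniq_mem ?leq_b1.
apply: count_mem_uniq => j; rewrite count_mem_mset in_mset.
have [lt|ge] := ltnP j M; last by rewrite mset_of_out.
by have := m1 (Ordinal lt); rewrite -[j]/(val (Ordinal lt)) mset_of_ord; case: (m _) => [|[]].
Qed.

(** The factors of a monomial in the first [M] variables only involve these
    variables. *)
Lemma truncates_mul f g p q :
  truncates f p -> truncates g q -> truncates (series_mul f g) (p * q).
Proof.
move=> fp gq m; rewrite mcoeffM bigfs ?index_enum_uniq //; last first.
  by move=> i _; rewrite mem_index_enum.
rewrite /series_mul.
rewrite (reindex_fsbig
   (fun k : 'X_{1..M < (mdeg m).+1, (mdeg m).+1} => (mset_of k.1, mset_of k.2))
   [set` [pred k : 'X_{1..M < (mdeg m).+1, (mdeg m).+1} | m == (k.1 + k.2)%MM]]%classic).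
  by apply: eq_fsbigr => k _; rewrite fp gq.
split.
- by move=> k /= /eqP mk; rewrite -mset_ofD -mk.
- move=> [k1 k2] [l1 l2] _ _ [/mset_of_inj /val_inj -> /mset_of_inj /val_inj ->] //.
- move=> [A B] /= AB.
  have out j : (M <= j)%N -> A j = 0%N /\ B j = 0%N.
    by move=> /(mset_of_out m) /eqP; rewrite -AB msetE2 addn_eq0 => /andP[/eqP-> /eqP->].
  have [k1 kA] := mset_of_surj (fun j Mj => (out j Mj).1).
  have [k2 kB] := mset_of_surj (fun j Mj => (out j Mj).2).
  have mk : m = (k1 + k2)%MM by apply: mset_of_inj; rewrite mset_ofD kA kB.
  have lt1 : (mdeg k1 < (mdeg m).+1)%N by rewrite mk mdegD ltnS leq_addr.
  have lt2 : (mdeg k2 < (mdeg m).+1)%N by rewrite mk mdegD ltnS leq_addl.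
  by exists (BMultinom lt1, BMultinom lt2); rewrite /= ?kA ?kB //; apply/eqP.
Qed.

Lemma truncates_elem_prod la :
  truncates (elem_prod la) (\prod_(i <- la) mesym M rat i).
Proof.
rewrite /elem_prod; elim: la => [|i la IH].
  by rewrite !big_nil; apply: truncates_series1.
by rewrite !big_cons; apply: truncates_mul => //; apply: truncates_elem.
Qed.

(** The colourings whose monomial involves only the first [M] variables are
    those with values in ['I_M]. *)
Lemma truncates_chromatic_sym (G : sgraph) (f : G -> G) :
  (forall x y : G, adj x y = (y == f x) || (x == f y)) ->
  truncates (chromatic_sym G) (chromatic_sum f (fun i : 'I_M => 'X_i)).
Proof.
move=> adjE m; rewrite /chromatic_sum raddf_sum /=.
have monE (kappa : {ffun G -> 'I_M}) :
    \prod_v 'X_(kappa v) = 'X_[\sum_v U_(kappa v)] :> {mpoly rat[M]}.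
  by rewrite (big_morph (fun m : 'X_{1..M} => 'X_[m]) (@mpolyXD _ _) (@mpolyX0 _ _)).
under eq_bigr do rewrite monE mcoeffX mulrb.
rewrite -big_mkcondr bigfs ?index_enum_uniq //; last first.
  by move=> i _; rewrite mem_index_enum.
rewrite /chromatic_sym.
pose h (kappa : {ffun G -> 'I_M}) : {ffun G -> nat} := [ffun v => val (kappa v)].
have h_mon kappa : colouring_monomial (h kappa) = mset_of (\sum_v U_(kappa v)).
  apply/msetP => j; rewrite /colouring_monomial mset_seqE count_map mset_ofE.
  rewrite -sum1_count big_enum_cond big_mkcond /=.
  under [RHS]eq_bigr do rewrite mnm_sumE.
  rewrite exchange_big /=; apply: eq_bigr => v _; rewrite ffunE big_mkcond.
  rewrite (bigD1 (kappa v)) //= mnm1E eqxx big1 ?addn0 => [|i]; first by case: ifP.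
  by rewrite mnm1E eq_sym => /negPf ->; rewrite if_same.
rewrite [RHS](reindex_fsbig h
   [set` [pred kappa : {ffun G -> 'I_M} |
      proper_map f kappa && ((\sum_v U_(kappa v))%MM == m)]]%classic) //.
split.
- move=> kappa /= /andP[/forallP pk /eqP <-]; split=> // x y; rewrite adjE !ffunE.
  by move=> /orP[/eqP ->|/eqP ->] /val_inj E;
    [have := pk x|have := pk y]; rewrite E eqxx.
- move=> k1 k2 _ _ /ffunP E; apply/ffunP => v; apply: val_inj.
  by have := E v; rewrite !ffunE.
- move=> kappa /= [pk km].
  have lt v : (kappa v < M)%N.
    rewrite ltnNge; apply/negP => /(mset_of_out m); rewrite -km mset_seqE.
    by apply/eqP; rewrite -lt0n -has_count has_pred1 map_f ?mem_enum.
  pose kappa' : {ffun G -> 'I_M} := [ffun v => Ordinal (lt v)].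
  have hE : h kappa' = kappa by apply/ffunP => v; rewrite !ffunE.
  exists kappa' => //=; apply/andP; split; last first.
    by apply/eqP/mset_of_inj; rewrite -h_mon hE.
  apply/forallP => v; rewrite !ffunE -val_eqE /=; apply/eqP; apply: pk.
  by rewrite adjE eqxx.
Qed.

End Truncation.

(** * Existence of the elementary expansion *)

(** The coefficients are required to be the same for all numbers of variables;
    this is what makes them the coefficients of an expansion of a series.
    Arbitrary index sequences, rather than partitions, make the closure under
    products immediate. *)
Definition e_span (F : forall M, {mpoly rat[M]}) : Prop :=
  exists l : seq (rat * seq nat),
    forall M, F M = \sum_(t <- l) t.1 *: \prod_(i <- t.2) mesym M rat i.

Lemma eq_e_span F G : (forall M, F M = G M) -> e_span F -> e_span G.
Proof. by move=> FG [l lF]; exists l => M; rewrite -FG. Qed.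

Lemma e_spanC c : e_span (fun M => c%:MP).
Proof.
by exists [:: (c, [::])] => M; rewrite big_seq1 big_nil /= -mul_mpolyC mulr1.
Qed.

Lemma e_span_mesym i : e_span (fun M => mesym M rat i).
Proof. by exists [:: (1, [:: i])] => M; rewrite !big_seq1 scale1r. Qed.

Lemma e_spanD F G : e_span F -> e_span G -> e_span (fun M => F M + G M).
Proof. by move=> [l lF] [r rG]; exists (l ++ r) => M; rewrite big_cat /= -lF -rG. Qed.

Lemma e_spanM F G : e_span F -> e_span G -> e_span (fun M => F M * G M).
Proof.
move=> [l lF] [r rG].
exists [seq (t.1 * s.1, t.2 ++ s.2) | t <- l, s <- r] => M.
rewrite lF rG big_allpairs_dep /= big_distrl /=; apply: eq_bigr => t _.
rewrite big_distrr /=; apply: eq_bigr => s _.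
by rewrite big_cat /= -scalerAl -scalerAr scalerA.
Qed.

Lemma e_span_sum (I : Type) (r : seq I) (P : pred I) (F : I -> forall M, {mpoly rat[M]}) :
  (forall i, P i -> e_span (F i)) -> e_span (fun M => \sum_(i <- r | P i) F i M).
Proof.
move=> eF; elim: r => [|i r IHr].
  by apply: eq_e_span (e_spanC 0) => M; rewrite big_nil mpolyC0.
have [Pi|Pi] := boolP (P i).
  by apply: eq_e_span (e_spanD (eF i Pi) IHr) => M; rewrite big_cons Pi.
by apply: eq_e_span IHr => M; rewrite big_cons (negPf Pi).
Qed.

Lemma e_span_prod (I : Type) (r : seq I) (P : pred I) (F : I -> forall M, {mpoly rat[M]}) :
  (forall i, P i -> e_span (F i)) -> e_span (fun M => \prod_(i <- r | P i) F i M).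
Proof.
move=> eF; elim: r => [|i r IHr].
  by apply: eq_e_span (e_spanC 1) => M; rewrite big_nil mpolyC1.
have [Pi|Pi] := boolP (P i).
  by apply: eq_e_span (e_spanM (eF i Pi) IHr) => M; rewrite big_cons Pi.
by apply: eq_e_span IHr => M; rewrite big_cons (negPf Pi).
Qed.

Lemma esum_mpolyX M j : esum (fun i : 'I_M => 'X_i : {mpoly rat[M]}) j = mesym M rat j.
Proof. by []. Qed.

Lemma e_span_epoly j : e_span (fun M => (epoly (fun i : 'I_M => 'X_i : {mpoly rat[M]}))`_j).
Proof.
apply: eq_e_span (e_spanM (e_spanC ((-1) ^+ j)) (e_span_mesym j)) => M.
by rewrite coef_epoly esum_mpolyX rmorphXn rmorphN1.
Qed.

(** Newton's identity solved for the power sum of highest index. *)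
Lemma e_span_psum j : (0 < j)%N ->
  e_span (fun M => psum (fun i : 'I_M => 'X_i : {mpoly rat[M]}) j).
Proof.
elim/ltn_ind: j => -[//|j] IHj _.
pose E M l : {mpoly rat[M]} := (epoly (fun i : 'I_M => 'X_i : {mpoly rat[M]}))`_l.
pose p M l : {mpoly rat[M]} := psum (fun i : 'I_M => 'X_i : {mpoly rat[M]}) l.
have E0 M : E M 0%N = 1 by rewrite /E coef_epoly esum_mpolyX mesym0E mulr1.
apply: (@eq_e_span (fun M => (-1)%:MP * (j.+1%:R%:MP * E M j.+1 +
    \sum_(l < j) E M l.+1 * p M (j - l)%N))) => [M|].
  rewrite -/(E M j.+1) -/(p M j.+1); have := newton (fun i : 'I_M => 'X_i : {mpoly rat[M]}) j.
  rewrite -/(E M j.+1) big_ord_recl /= -/(E M 0%N) E0 mul1r subn0 -/(p M j.+1).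
  rewrite rmorphN1 rmorph_nat => ->.
  under [X in - (_ + X)]eq_bigr do rewrite /bump /= add1n subSS.
  by rewrite mulN1r opprD opprK addrK.
apply: e_spanM (e_spanC _) _; apply: e_spanD.
  exact: e_spanM (e_spanC _) (e_span_epoly _).
apply: e_span_sum => l _; apply: e_spanM (e_span_epoly _) _.
by apply: IHj; have := ltn_ord l; lia.
Qed.

Lemma e_span_chromatic_sum (V : finType) (f : V -> V) c : c \in core f ->
  e_span (fun M => chromatic_sum f (fun i : 'I_M => 'X_i : {mpoly rat[M]})).
Proof.
move=> cc; apply: eq_e_span => [M|]; first by rewrite (chromatic_sum_psum _ cc).
apply: e_span_sum => S _; apply: e_spanM.
  by apply: eq_e_span (e_spanC ((-1) ^+ #|S|)) => M; rewrite rmorphXn rmorphN1.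
apply: e_span_prod => w; rewrite inE => wS; apply: e_span_psum.
by apply/card_gt0P; exists w; rewrite inE sink_id.
Qed.

(** Zero indices may be dropped because [mesym M rat 0 = 1]. *)
Definition canonical_partition (la : seq nat) : seq nat :=
  sort geq [seq i <- la | 0%N != i].

Lemma canonical_partitionP la : is_partition (canonical_partition la).
Proof.
rewrite /is_partition /canonical_partition mem_sort mem_filter eqxx andbT.
by apply: sort_sorted => i j; apply: leq_total.
Qed.

Lemma prod_canonical_partition la M :
  \prod_(i <- canonical_partition la) mesym M rat i = \prod_(i <- la) mesym M rat i.
Proof.
rewrite (perm_big _ (permEl (perm_sort geq _))) /= big_filter big_mkcond /=.
by apply: eq_bigr => -[|i] _ //=; rewrite mesym0E.
Qed.

(** Terms with the same underlying partition are collected; the equality of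
    the coefficients of a monomial [m] is then checked in a polynomial ring
    that has all the variables of [m]. *)
Lemma e_expansion_of_e_span X F :
  (forall M, truncates X (F M)) -> e_span F -> exists c, e_expansion X c.
Proof.
move=> XF [l lF]; pose part (t : rat * seq nat) := canonical_partition t.2.
have [D DE] : {D : {fset seq nat} | D =i map part l}.
  by exists (seq_fset tt (map part l)) => la; rewrite seq_fsetE.
pose c : {fsfun seq nat -> rat with 0} :=
  [fsfun la in D => \sum_(t <- l | part t == la) t.1].
have suppD : (finsupp c `<=` D)%fset by apply: finsupp_sub.
exists c; split=> [la /(fsubsetP suppD)|m].
  by rewrite DE => /mapP[t _ ->]; apply: canonical_partitionP.
(* Enough variables for all those that occur in [m]. *)
pose M := (\max_(j <- finsupp m) j).+1.
have [j|mm <-] := @mset_of_surj M m.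
  rewrite ltnNge => /negP jM; apply/eqP; rewrite mset_eq0 -multiset.msuppE.
  apply/negP => jm; apply: jM.
  by rewrite (big_fsetD1 j) //= leq_maxl.
rewrite -XF lF raddf_sum /=.
under eq_bigr => t _.
  rewrite mcoeffZ -prod_canonical_partition -/(part t) truncates_elem_prod.
  over.
set g := fun la => elem_prod la (mset_of mm).
rewrite (big_fset_incl _ suppD) /=; last first.
  by move=> la _ /fsfun_dflt ->; rewrite mul0r.
transitivity (\sum_(la <- D) \sum_(t <- l | part t == la) t.1 * g la); last first.
  by rewrite big_seq [RHS]big_seq; apply: eq_bigr => la laD; rewrite /c fsfunE laD big_distrl.
rewrite (exchange_big_dep xpredT) //= big_seq [RHS]big_seq; apply: eq_bigr => t tl.
rewrite big_mkcond (big_fsetD1 (part t)) /= ?eqxx; last by rewrite DE map_f.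
rewrite big_seq big1 ?addr0 // => la; rewrite in_fsetD1 => /andP[/negPf nla _].
by rewrite eq_sym nla.
Qed.

(** * Extraction of a coefficient with two parts *)

(** The [x i] are the inverses of the roots of [q], which are nonzero since
    [q] has constant coefficient 1. *)
Lemma epoly_surj (F : closedFieldType) (q : {poly F}) : q`_0 = 1 ->
  exists M (x : 'I_M -> F), epoly x = q.
Proof.
move=> q0; have [r qr] := closed_field_poly_normal q.
have lc0 : lead_coef q != 0.
  by rewrite lead_coef_eq0; apply: contra_eq_neq q0 => ->; rewrite coef0 eq_sym oner_eq0.
have rn0 z : z \in r -> z != 0.
  move=> zr; apply/eqP => z0; have : q.[0] = 0.
    by apply/eqP; rewrite -rootE qr rootZ // root_prod_XsubC -z0.
  by rewrite horner_coef0 q0 => /eqP; rewrite oner_eq0.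
pose x (i : 'I_(size r)) := (r`_i)^-1; exists (size r), x.
have ex : epoly x = (\prod_(z <- r) - z^-1) *: \prod_(z <- r) ('X - z%:P).
  rewrite -scaler_prod (big_nth 0) big_mkord; apply: eq_bigr => i _.
  rewrite /x scalerBr -(alg_polyC r`_i) scalerA mulNr mulVf ?rn0 ?mem_nth //.
  by rewrite scaleN1r opprK scaleNr addrC.
have ex0 := coef0_epoly x.
move: ex0 q0; rewrite ex qr !coefZ; set p0 := (\prod_(z <- r) ('X - z%:P))`_0.
move=> e1 e2; congr (_ *: _); apply: (mulIf (x := p0)); last by rewrite e1 e2.
by apply: contra_eq_neq e1 => ->; rewrite mulr0 eq_sym oner_eq0.
Qed.

(** The factor 'X in the coordinates records degrees, so that partitions of
    different numbers are told apart after evaluation. *)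
Lemma two_part_point (F : closedFieldType) (a b : nat) :
  exists M (y : 'I_M -> {poly F}), forall l, (0 < l)%N ->
    esum y l = 'X^l *+ ((l == a) || (l == b)).
Proof.
pose q : {poly F} := \poly_(l < (a + b).+1)
  (if l == 0%N then 1 else (-1) ^+ l *+ ((l == a) || (l == b))).
have [|M [x xq]] := @epoly_surj F q; first by rewrite coef_poly.
exists M, (fun i => x i *: 'X) => l l0.
rewrite /esum (eq_bigr (fun A : {set 'I_M} => (\prod_(i in A) x i) *: 'X^l)); last first.
  by move=> A /eqP <-; rewrite scaler_prod prodr_const.
rewrite -scaler_suml -/(esum x l).
suff -> : esum x l = ((l == a) || (l == b))%:R by rewrite scaler_nat.
have : (-1) ^+ l * (-1) ^+ l = 1 :> F by rewrite -expr2 sqrr_sign.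
move=> sgn; rewrite -[LHS]mul1r -sgn -mulrA -coef_epoly xq coef_poly.
rewrite (gtn_eqF l0); case: ifP => [_|lt].
  by rewrite mulrnAr sgn.
by rewrite mulr0; case: eqP lt => [->|_]; [lia|case: eqP => [->|//]; lia].
Qed.

(** One part is too small, and three sum to at least 3 b > a + b. *)
Lemma two_part_partition (a b : nat) la :
  (b <= a)%N -> (a < 2 * b)%N -> is_partition la ->
  all (fun l => (l == a) || (l == b)) la -> sumn la = (a + b)%N -> la = [:: a; b].
Proof.
move=> ba ab /andP[]; case: la => [|i [|j [|l la]]] /=; try lia.
by move=> ij _ abij s; congr [:: _; _]; lia.
Qed.

(** Evaluating an arbitrary expansion at a point of [two_part_point] kills
    every e_la with a part other than a and b, and the coefficient of degree
    a + b singles out e_(a,b) among the rest. *)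
Lemma e_coef_two_parts (X : series) (P : forall M, {mpoly rat[M]}) (a b : nat) (v : rat) :
  (b <= a)%N -> (a < 2 * b)%N -> (forall M, truncates X (P M)) ->
  (forall M (y : 'I_M -> {poly algC}),
     (forall l, (0 < l)%N -> esum y l = 'X^l *+ ((l == a) || (l == b))) ->
     (mmap (polyC \o ratr) y (P M))`_(a + b) = ratr v) ->
  forall c, e_expansion X c -> c [:: a; b] = v.
Proof.
move=> le_ba lt_a2b XP Pv c [c_part cX].
have [M [y ey]] := two_part_point algC a b.
have PE : P M = \sum_(la <- finsupp c) c la *: \prod_(i <- la) mesym M rat i.
  apply/mpolyP => m; rewrite XP cX raddf_sum; apply: eq_bigr => la _ /=.
  by rewrite mcoeffZ truncates_elem_prod.
have mmap_mesym i : mmap (polyC \o ratr) y (mesym M rat i) = esum y i.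
  rewrite raddf_sum /=; apply: eq_bigr => A _; rewrite rmorph_prod /=.
  by apply: eq_bigr => j _; rewrite mmapX mmap1U.
apply: (fmorph_inj (ratr : {rmorphism rat -> algC})).
rewrite /= -(Pv M y ey) PE raddf_sum coef_sum /=.
have term la : is_partition la ->
    (mmap (polyC \o ratr) y (c la *: \prod_(i <- la) mesym M rat i))`_(a + b) =
    (if la == [:: a; b] then ratr (c la) else 0 : algC).
  move=> la_part; rewrite mmapZ rmorph_prod /= coefCM.
  have prodE : \prod_(i <- la) mmap (polyC \o ratr) y (mesym M rat i) =
      'X^(sumn la) *+ all (fun l => (l == a) || (l == b)) la :> {poly algC}.
    have : 0%N \notin la by case/andP: la_part.
    elim: (la) => [|i la' IH] /=; first by rewrite big_nil.
    rewrite inE negb_or big_cons => /andP[i0 /IH ->].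
    rewrite mmap_mesym ey ?lt0n 1?eq_sym // exprD.
    by case: (_ || _); case: (all _ _); rewrite /= ?mulr1n ?mulr0n ?mulr0 ?mul0r.
  rewrite prodE coefMn coefXn -mulrnA mulnb.
  have -> : ((a + b)%N == sumn la) && all (fun l => (l == a) || (l == b)) la
      = (la == [:: a; b]).
    apply/andP/eqP => [[/eqP s al]|->]; first exact: two_part_partition.
    by rewrite /= !eqxx orbT addn0.
  by case: eqP; rewrite ?mulr1 ?mulr0.
have -> : ratr (c [:: a; b]) =
    \sum_(la <- finsupp c) if la == [:: a; b] then ratr (c la) else 0 :> algC.
  have [in_c|nin] := boolP ([:: a; b] \in finsupp c).
    rewrite (big_fsetD1 _ in_c) /= eqxx big_seq big1 ?addr0 // => la.
    by rewrite in_fsetD1 => /andP[/negPf ->].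
  rewrite (fsfun_dflt nin) rmorph0 big_seq big1 // => la lac; case: eqP => // E.
  by rewrite -E lac in nin.
by rewrite big_seq [RHS]big_seq; apply: eq_bigr => la /c_part /term ->.
Qed.

(** * The coefficients for sun graphs *)

Lemma mmap_chromatic_sum (V : finType) (f : V -> V) (S : comNzRingType)
    (phi : {rmorphism rat -> S}) M (y : 'I_M -> S) :
  mmap phi y (chromatic_sum f (fun i => 'X_i)) = chromatic_sum f y.
Proof.
rewrite /chromatic_sum raddf_sum; apply: eq_bigr => kappa _ /=.
by rewrite rmorph_prod; apply: eq_bigr => v _; rewrite /= mmapX mmap1U.
Qed.

Lemma e_coef_sun (n k a b : nat) :
  (3 <= n)%N -> (b <= a)%N -> (a < 2 * b)%N -> (n * k.+1 = a + b)%N ->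
  (k < b)%N -> ~~ (k.+1 %| b)%N ->
  e_coef (chromatic_sym (sun n k)) [:: a; b]
    ((if a == b then a else (a + b)%N)%:R * (1 - n%:R)).
Proof.
move=> n3 le_ba lt_a2b nk kb kNb.
have n0 : (0 < n)%N by lia.
pose P M : {mpoly rat[M]} := chromatic_sum (@sun_next n k) (fun i => 'X_i).
have XP M : truncates (chromatic_sym (sun n k)) (P M).
  by apply: truncates_chromatic_sym => x y; apply: sun_relE; lia.
split.
  apply: e_expansion_of_e_span XP _; apply: (@e_span_chromatic_sum _ _ (inl (Ordinal n0))).
  by rewrite core_sun imset_f.
apply: (e_coef_two_parts le_ba lt_a2b XP) => M y ey.
rewrite mmap_chromatic_sum (chromatic_sum_sun le_ba lt_a2b nk kb kNb ey).
rewrite -!polyC_natr -polyC1 -polyCB -polyCM coefCM coefXn eqxx mulr1.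
by rewrite rmorphM rmorphB rmorph1 !rmorph_nat.
Qed.

Lemma e_coef_sun_distinct (n k a b : nat) :
  (3 <= n)%N -> (b < a)%N -> (a < 2 * b)%N -> (n * k.+1 = a + b)%N ->
  (k < b)%N -> ~~ (k.+1 %| b)%N ->
  e_coef (chromatic_sym (sun n k)) [:: a; b] (n%:R * (k%:R + 1) * (1 - n%:R)).
Proof.
move=> n3 lt_ba lt_a2b nk kb kNb.
have := e_coef_sun n3 (ltnW lt_ba) lt_a2b nk kb kNb.
by rewrite gtn_eqF // -nk natrM -natr1.
Qed.

Theorem lemma3p4 (n : nat) (hn : (3 <= n)%N) :
  [/\ ~~ odd n ->
        e_coef (chromatic_sym (sun n 1)) [:: (n + 1)%N; (n - 1)%N]
               (2 * n%:R * (1 - n%:R)),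
      odd n ->
        e_coef (chromatic_sym (sun n 1)) [:: n; n] (n%:R * (1 - n%:R)),
      forall k : nat, (2 <= k)%N -> ~~ odd (n * (k + 1)) ->
        e_coef (chromatic_sym (sun n k))
               [:: (n * (k + 1) %/ 2 + 1)%N; (n * (k + 1) %/ 2 - 1)%N]
               (n%:R * (k%:R + 1) * (1 - n%:R))
    & forall k : nat, (2 <= k)%N -> odd (n * (k + 1)) ->
        e_coef (chromatic_sym (sun n k))
               [:: ((n * (k + 1) + 1) %/ 2)%N; ((n * (k + 1) - 1) %/ 2)%N]
               (n%:R * (k%:R + 1) * (1 - n%:R))].
Proof.
have large k : (2 <= k)%N -> (3 * k.+1 <= n * k.+1)%N by rewrite leq_mul2r hn orbT.
split.
- move=> n_even.
  have -> : 2 * n%:R = n%:R * (1%:R + 1) :> rat by ring.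
  apply: e_coef_sun_distinct => //; lia.
- move=> n_odd.
  have := @e_coef_sun n 1 n n; rewrite eqxx; apply=> //; lia.
- move=> k k2; rewrite addn1 => nk_even; have := large k k2.
  have [h hE] : {h | n * k.+1 = 2 * h}%N by exists (n * k.+1)./2; lia.
  rewrite hE mulKn // => le_h.
  apply: e_coef_sun_distinct => //; try lia.
  (* If k + 1 divides h - 1 and 2 h, it divides 2. *)
  apply/negP => dvd; have : (k.+1 %| 2 * h - 2 * (h - 1))%N.
    by rewrite dvdn_sub // -?hE ?dvdn_mull.
  by have -> : (2 * h - 2 * (h - 1) = 2)%N by [lia]; move/dvdn_leq => /(_ isT); lia.
- move=> k k2; rewrite addn1 => nk_odd; have := large k k2.
  have [h hE] : {h | n * k.+1 = 2 * h + 1}%N by exists (n * k.+1)./2; lia.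
  rewrite hE (_ : (2 * h + 1 + 1) %/ 2 = h + 1)%N; last lia.
  rewrite (_ : (2 * h + 1 - 1) %/ 2 = h)%N; last lia.
  move=> le_h; apply: e_coef_sun_distinct => //; try lia.
  apply/negP => dvd; have : (k.+1 %| 2 * h + 1)%N by rewrite -hE dvdn_mull.
  by rewrite dvdn_addr ?dvdn_mull // => /dvdn_leq => /(_ isT); lia.
Qed.
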